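(* Let $\mathbb{K}$ be a field of characteristic zero and $Y=\{y_i\}_{i\ge1}$. Let $P=\sum_{\underline{y}\in Y^*} M^{\underline{y}}\,\underline{y}\in\mathbb{K}\langle\langle Y\rangle\rangle$. Then $P$ is group-like for $\Delta_*$, i.e. $\Delta_*(P)=P\otimes P$, if and only if $M^\bullet$ is a symetrel mould.
   Context: $Y^*$ is the set of words on $Y$, including the empty word $\emptyset=1$; by convention $y_0=\emptyset=1$. $\mathbb{K}\langle\langle Y\rangle\rangle$ is the algebra of non-commutative formal power series on $Y$. The coproduct $\Delta_*$ is the (completed) algebra morphism $\mathbb{K}\langle\langle Y\rangle\rangle\to \mathbb{K}\langle\langle Y\rangle\rangle\hat\otimes\mathbb{K}\langle\langle Y\rangle\rangle$ determined by $\Delta_*(y_r)=\sum_{i+j=r,\ i,j\ge 0} y_i\otimes y_j$ and $\Delta_*(\underline{y}^1\underline{y}^2)=\Delta_*(\underline{y}^1)\Delta_*(\underline{y}^2)$, extended by linearity. A mould on $Y$ is a map $M^\bullet:Y^*\to\mathbb{K}$. For words $\underline{y}^1,\underline{y}^2$, the contracting shuffle $\mathrm{csh}(\underline{y}^1,\underline{y}^2)$ consists of the words obtained by interleaving $\underline{y}^1$ and $\underline{y}^2$ (preserving the internal order of each), followed by the possible contraction of one or several pairs $(y_i,y_j)$ of consecutive letters, $y_i$ coming from $\underline{y}^1$ and $y_j$ from $\underline{y}^2$, into the single letter $y_{i+j}$. Sums over $\mathrm{csh}$ are counted with multiplicity, one term for each interleaving-with-contractions. The mould $M^\bullet$ is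 symetrel if $\sum_{\underline{y}\in\mathrm{csh}(\underline{y}^1,\underline{y}^2)}M^{\underline{y}}=M^{\underline{y}^1}M^{\underline{y}^2}$ for all $\underline{y}^1,\underline{y}^2\in Y^*$. *)

(* Defs.v *)
From mathcomp Require Import all_boot all_algebra.
From mathcomp Require Import boolp classical_sets functions cardinality fsbigop.

Set Implicit Arguments.
Unset Strict Implicit.
Unset Printing Implicit Defensive.

Import GRing.Theory.
Local Open Scope ring_scope.

(* The letter y_i, i >= 1, is represented by its index i. *)
Definition letter := {i : nat | (0 < i)%N}.

Definition word := seq letter.

Lemma add_letter_subproof (a b : letter) : (0 < val a + val b)%N.
Proof. by rewrite addn_gt0 (valP a). Qed.

Definition add_letter (a b : letter) : letter :=
  exist _ (val a + val b)%N (add_letter_subproof a b).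

(* y_i as a word, for every natural number i, with y_0 the empty word. *)
Definition yword (i : nat) : word := seq_of_opt (insub i : option letter).

(* A mould M and the series \sum_w M^w w have the same underlying data. They
   are nevertheless kept apart: a series is built from a mould with
   [formal_sum]. *)
Definition mould (K : fieldType) := word -> K.

Definition ncseries (K : fieldType) := word -> K.

(* The completed tensor square of the algebra of series: possibly infinite
   linear combinations of the u (x) v, for u and v words. *)
Definition ncseries2 (K : fieldType) := word * word -> K.

(* Sum of a family of series (S = word) or of elements of the completed tensor
   square (S = word * word), coefficient by coefficient. It is meaningful for
   families in which every coefficient is nonzero for finitely many indices:
   the finitely supported sum is 0 by default otherwise. *)
Definition formal_sum (K : fieldType) (S : Type) (F : word -> S -> K) : S -> K :=
  fun s => \sum_(w \in [set: word]%classic) F w s.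

Definition monom (K : fieldType) (w : word) : ncseries K :=
  fun w' => (w' == w)%:R.

Definition tens (K : fieldType) (P Q : ncseries K) : ncseries2 K :=
  fun uv => P uv.1 * Q uv.2.

Definition one2 (K : fieldType) : ncseries2 K := tens (monom K [::]) (monom K [::]).

(* The product determined by (u (x) v) (u' (x) v') = uu' (x) vv'. *)
Definition mul2 (K : fieldType) (F G : ncseries2 K) : ncseries2 K :=
  fun uv =>
    \sum_(i < (size uv.1).+1) \sum_(j < (size uv.2).+1)
      F (take i uv.1, take j uv.2) * G (drop i uv.1, drop j uv.2).

Definition coprod_letter (K : fieldType) (a : letter) : ncseries2 K :=
  fun uv => \sum_(i < (val a).+1)
    tens (monom K (yword i)) (monom K (yword (val a - i))) uv.

Definition coprod_word (K : fieldType) (w : word) : ncseries2 K :=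
  foldr (fun a F => mul2 (coprod_letter K a) F) (one2 K) w.

Definition coprod (K : fieldType) (P : ncseries K) : ncseries2 K :=
  formal_sum (fun w uv => P w * coprod_word K w uv).

Definition grouplike (K : fieldType) (P : ncseries K) : Prop :=
  coprod P = tens P P.

(* All interleavings of s and t, with multiplicity. *)
Fixpoint interleave (T : Type) (s t : seq T) {struct s} : seq (seq T) :=
  match s with
  | [::] => [:: t]
  | x :: s' =>
    (fix interleave_s (t : seq T) : seq (seq T) :=
      match t with
      | [::] => [:: s]
      | y :: t' => [seq x :: r | r <- interleave s' t] ++
                   [seq y :: r | r <- interleave_s t']
      end) t
  end.

Definition untag (x : letter + letter) : letter :=
  match x with inl a => a | inr a => a end.

(* A tagged word records the origin of its letters: inl for the first word, inr
   for the second. A letter of the first word immediately followed by a letter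
   of the second may be contracted; pairs in the opposite order may not. *)
Fixpoint contractions (s : seq (letter + letter)) : seq word :=
  match s with
  | [::] => [:: [::]]
  | x :: s' =>
    [seq untag x :: r | r <- contractions s'] ++
    match x, s' with
    | inl a, inr b :: s'' => [seq add_letter a b :: r | r <- contractions s'']
    | _, _ => [::]
    end
  end.

Definition csh (u v : word) : seq word :=
  flatten [seq contractions s | s <- interleave (map inl u) (map inr v)].

Definition symetrel (K : fieldType) (M : mould K) : Prop :=
  forall u v : word, \sum_(w <- csh u v) M w = M u * M v.

Lemma formal_sum_monom (K : fieldType) (M : mould K) :
  formal_sum (fun w w' => M w * monom K w w') = M.
Proof.
apply/funext => w; rewrite /formal_sum.
rewrite -(fsbig_widen [set w]%classic setT) => [||w' [_ /= ww']] //.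
  by rewrite fsbig_set1 /monom eqxx mulr1.
rewrite /monom; case: eqP => [e|_]; last by rewrite mulr0.
by case: ww'.
Qed.

Definition weight (w : word) : nat := sumn (map val w).

Lemma weight_cat u v : weight (u ++ v) = (weight u + weight v)%N.
Proof. by rewrite /weight map_cat sumn_cat. Qed.

Lemma weight_yword i : weight (yword i) = i.
Proof.
rewrite /yword; case: insubP => [a _ <-|] /=; first by rewrite /weight /= addn0.
by case: i.
Qed.

Lemma coprod_word_weight (K : fieldType) (w u v : word) :
  coprod_word K w (u, v) != 0 -> (weight u + weight v)%N = weight w.
Proof.
elim: w u v => [|a w IH] u v /=.
  rewrite /one2 /tens /monom /=.
  by case: (u =P _) => [->|_]; case: (v =P _) => [->|_]; rewrite ?mul0r ?mulr0 ?eqxx.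
rewrite /mul2 /= => nz.
apply: contraNeq nz => wt; apply/eqP.
rewrite big1 // => i _; rewrite big1 // => j _.
apply/eqP; apply: contraNT wt; rewrite mulf_eq0 negb_or => /andP[nza /IH wt].
rewrite -(cat_take_drop i u) -(cat_take_drop j v) !weight_cat addnACA wt.
rewrite [weight (a :: w)]/weight /= -/(weight w) eqn_add2r.
apply: contraNT nza => wt'; rewrite /coprod_letter big1 // => k _.
rewrite /tens /monom /=; case: eqP => [eu|_]; last by rewrite mul0r.
case: eqP => [ev|_]; last by rewrite mulr0.
by move: wt'; rewrite eu ev !weight_yword subnKC ?eqxx // -ltnS.
Qed.

Lemma finite_weight (n : nat) : finite_set [set w | weight w = n]%classic.
Proof.
pose ls : seq letter := pmap insub (iota 0 n.+1).
pose fix ws k : seq word :=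
  if k is k'.+1 then [::] :: allpairs cons ls (ws k') else [:: [::]].
suff wsP k w : (weight w <= n)%N -> (size w <= k)%N -> w \in ws k.
  apply: (sub_finite_set (B := [set` ws n]%classic)); last exact: finite_seq.
  move=> w /= wn; apply: wsP; rewrite ?wn // -wn.
  elim: (w) => //= a w' IH; rewrite /weight /= -/(weight w').
  by rewrite -add1n leq_add // (valP a).
elim: k w => [|k IH] [|a w] //; rewrite /weight /= -/(weight w) => wn sw.
rewrite in_cons /=; apply: (@allpairs_f _ _ _ cons ls (ws k)).
  rewrite mem_pmap; apply/mapP; exists (val a); last by rewrite valK.
  by rewrite mem_iota /= add0n ltnS (leq_trans (leq_addr _ _) wn).
by apply: IH => //; apply: leq_trans wn; rewrite leq_addl.
Qed.

Lemma finite_coprod (K : fieldType) (P : ncseries K) (uv : word * word) :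
  finite_set [set w | P w * coprod_word K w uv != 0]%classic.
Proof.
case: uv => u v; apply: sub_finite_set (finite_weight (weight u + weight v)).
by move=> w /=; rewrite mulf_eq0 negb_or => /andP[_ /coprod_word_weight ->].
Qed.

Lemma mul2_one (K : fieldType) (F : ncseries2 K) : mul2 (one2 K) F = F.
Proof.
apply/funext => -[u v]; rewrite /mul2 /= !big_ord_recl /= !take0 !drop0.
have t0 (s : word) (i : 'I_(size s)) : take (bump 0 i) s == [::] = false.
  by case: s i => [[]|].
rewrite big1 => [|j _]; last by rewrite /one2 /tens /monom /= t0 mulr0 mul0r.
rewrite big1 => [|i _].
  by rewrite /one2 /tens /monom /= mulr1 mul1r !addr0.
by rewrite big1 // => j _; rewrite /one2 /tens /monom /= t0 !mul0r.
Qed.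

Lemma exchange_splits (V : nmodType) (f : word -> word -> word -> V) (u : word) :
  \sum_(i < (size u).+1) \sum_(k < (size (take i u)).+1)
     f (take k (take i u)) (drop k (take i u)) (drop i u) =
  \sum_(k < (size u).+1) \sum_(i < (size (drop k u)).+1)
     f (take k u) (take i (drop k u)) (drop i (drop k u)).
Proof.
elim: u f => [|a u IH] f; first by rewrite !big_ord1.
rewrite !(big_ord_recl (size (a :: u))) /= big_ord1 /=.
under eq_bigr => i _ do rewrite big_ord_recl /=.
by rewrite big_split /= (IH (fun x => f (a :: x))) addrA.
Qed.

Lemma mul2A (K : fieldType) (F G H : ncseries2 K) :
  mul2 F (mul2 G H) = mul2 (mul2 F G) H.
Proof.
apply/funext => -[u v]; rewrite /mul2 /=; apply/esym.
transitivity (\sum_(i < (size u).+1) \sum_(k < (size (take i u)).+1)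
  \sum_(j < (size v).+1) \sum_(l < (size (take j v)).+1)
  F (take k (take i u), take l (take j v)) *
  G (drop k (take i u), drop l (take j v)) * H (drop i u, drop j v)).
  apply: eq_bigr => i _; rewrite exchange_big; apply: eq_bigr => j _.
  by rewrite mulr_suml; apply: eq_bigr => k _; rewrite mulr_suml.
rewrite (exchange_splits (fun x y z => \sum_(j < (size v).+1)
  \sum_(l < (size (take j v)).+1) F (x, take l (take j v)) *
  G (y, drop l (take j v)) * H (z, drop j v))).
apply: eq_bigr => k _ /=.
under eq_bigr => i _ do rewrite (exchange_splits (fun x y z =>
  F (take k u, x) * G (take i (drop k u), y) * H (drop i (drop k u), z))).
rewrite exchange_big; apply: eq_bigr => l _; rewrite mulr_sumr.
apply: eq_bigr => i _; rewrite mulr_sumr; apply: eq_bigr => j _.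
by rewrite mulrA.
Qed.

Lemma coprod_word_cat (K : fieldType) (u v : word) :
  coprod_word K (u ++ v) = mul2 (coprod_word K u) (coprod_word K v).
Proof. by elim: u => [|a u IH] /=; rewrite ?mul2_one // IH mul2A. Qed.

(* Main.v *)
Require Import Defs.
From mathcomp Require Import all_boot all_algebra.
From mathcomp Require Import boolp classical_sets functions cardinality fsbigop.

(** The coefficient of [u (x) v] in the coproduct of a word [w] is the number of
    times [w] occurs in the contracting shuffle of [u] and [v]
    ([coprod_word_count]). Hence the coefficient of [u (x) v] in the coproduct
    of a series [P] is the sum of [P w] for [w] in [csh u v], with multiplicity
    ([coprod_csh]), and being group-like is the symetrel condition, read one
    coefficient at a time.

    The count holds because both sides obey the same recursion on the first
    letter of [w]: a word of [csh (a :: u) (b :: v)] begins with [a], with [b]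
    or with their contraction ([perm_csh_cons]), and these are the three ways in
    which the coproduct of one letter can supply a prefix of [a :: u] and a
    prefix of [b :: v] ([mul2_letter_cons]). *)

Set Implicit Arguments.
Unset Strict Implicit.
Unset Printing Implicit Defensive.

Import GRing.Theory.
Local Open Scope ring_scope.

Lemma csh0w (v : word) : csh [::] v = [:: v].
Proof.
rewrite /csh /= cats0.
by elim: v => //= b v ->.
Qed.

Lemma cshw0 (u : word) : csh u [::] = [:: u].
Proof.
rewrite /csh; have -> : interleave (map inl u) (map inr [::]) =
  [:: map inl u : seq (letter + letter)] by case: u.
rewrite /= cats0; elim: u => //= a u ->.
by case: u.
Qed.

Lemma perm_flatten_cat (S : Type) (T : eqType) (f g : S -> seq T) (l : seq S) :
  perm_eq (flatten [seq f s ++ g s | s <- l])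
          (flatten (map f l) ++ flatten (map g l)).
Proof.
elim: l => //= s l IH; apply/permP => p; rewrite !count_cat.
by move/permP: IH => ->; rewrite count_cat addnACA.
Qed.

Lemma flatten_map_cons (S T : Type) (x : T) (f : S -> seq (seq T)) (l : seq S) :
  flatten [seq map (cons x) (f s) | s <- l] = map (cons x) (flatten (map f l)).
Proof. by elim: l => //= s l ->; rewrite map_cat. Qed.

(** The words which contract [a] with the first letter of a tagged word [s]. *)
Definition head_contractions (a : letter) (s : seq (letter + letter)) :=
  if s is inr b :: s' then map (cons (add_letter a b)) (contractions s')
  else [::].

(** Among the interleavings of [u] and [b :: v], those that begin with a letter
    of the second word begin with [b], so that only [b] can be contracted with a
    letter placed in front. *)
Lemma flatten_head_contractions (a b : letter) (u v : word) :
  flatten (map (head_contractions a)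
             (interleave (map inl u) (map inr (b :: v)))) =
  map (cons (add_letter a b)) (csh u v).
Proof.
have nil_l (a' : letter) l :
    flatten [seq head_contractions a s | s <- map (cons (inl a')) l] = [::].
  by elim: l.
case: u => [|a' u]; first by rewrite csh0w -(csh0w v) /csh /= !cats0.
rewrite /= map_cat flatten_cat nil_l -map_comp.
exact: (@flatten_map_cons _ _ _ contractions).
Qed.

(** The recursion of the quasi-shuffle product. Contractions split according to
    whether the first tagged letter is contracted or not; since only a letter of
    the first word can be contracted with its right neighbour, the contraction
    of [a] with [b] occurs once and not twice. *)
Lemma perm_csh_cons (a b : letter) (u v : word) :
  perm_eq (csh (a :: u) (b :: v))
    (map (cons a) (csh u (b :: v)) ++ map (cons b) (csh (a :: u) v) ++
     map (cons (add_letter a b)) (csh u v)).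
Proof.
have -> : csh (a :: u) (b :: v) =
    flatten [seq map (cons a) (contractions s) ++ head_contractions a s
            | s <- interleave (map inl u) (map inr (b :: v))] ++
    map (cons b) (csh (a :: u) v).
  rewrite {1}/csh /= map_cat flatten_cat -!map_comp; congr (_ ++ _).
  rewrite -flatten_map_cons; congr (flatten _); apply: eq_map => s /=.
  exact: cats0.
apply/permP => p; rewrite count_cat (permP (perm_flatten_cat _ _ _)) !count_cat.
by rewrite flatten_map_cons flatten_head_contractions addnAC addnA.
Qed.

Lemma eq_yword (u : word) (i : nat) :
  (u == yword i) = (size u <= 1)%N && (weight u == i).
Proof.
apply/eqP/andP => [->|[+ /eqP <-]].
  by rewrite weight_yword /yword; case: insub.
case: u => [|a [|? ?]] //= _.
  by rewrite /yword insubF.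
by rewrite /weight /= addn0 /yword valK.
Qed.

(** Words of the form [yword i] are the words of length at most one, and [i] is
    then the weight, so that at most one summand is nonzero. The convention
    [y_0 = 1] is thus absorbed, without a separate case for the extreme
    summands. *)
Lemma coprod_letterE (K : fieldType) (c : letter) (u v : word) :
  coprod_letter K c (u, v) =
  [&& (size u <= 1)%N, (size v <= 1)%N & (weight u + weight v)%N == val c]%:R.
Proof.
rewrite /coprod_letter /tens /monom /=.
under eq_bigr => i _ do rewrite -natrM mulnb !eq_yword.
case su: (size u <= 1)%N; last by rewrite big1.
case sv: (size v <= 1)%N; last by rewrite big1 // => i _; rewrite andbF.
have [uc|cu] := ltnP (weight u) (val c).+1; last first.
  rewrite big1 => [|i _]; last by rewrite gtn_eqF // (leq_trans (ltn_ord i)).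
  by rewrite gtn_eqF // (leq_trans cu) ?leq_addr.
rewrite (bigD1 (Ordinal uc)) //= big1 => [|i iu].
  by rewrite addr0 eqxx /= -(eqn_add2l (weight u)) subnKC.
by rewrite [weight u == i]eq_sym (negbTE (_ : nat_of_ord i != weight u)).
Qed.

(** The coproduct of a letter involves only words of length at most one: in a
    product with it on the left, a split contributes only when it cuts off
    nothing or the first letter. *)
Lemma sum_splits_cons (V : nmodType) (f : word -> word -> V) (a : letter)
    (u : word) (f0 : forall x y, (1 < size x)%N -> f x y = 0) :
  \sum_(i < (size (a :: u)).+1) f (take i (a :: u)) (drop i (a :: u)) =
  f [::] (a :: u) + f [:: a] u.
Proof.
rewrite !big_ord_recl /= take0 drop0 big1 ?addr0 // => i _.
rewrite f0 //= ltnS size_take; case: ifP => // _.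
exact: leq_ltn_trans (leq0n _) (ltn_ord i).
Qed.

Section LetterProduct.

Variables (K : fieldType) (c : letter) (F : ncseries2 K).

Let coprod_letter_big (x y : word) :
  (1 < size x)%N || (1 < size y)%N -> coprod_letter K c (x, y) = 0.
Proof. by rewrite coprod_letterE; do 2!case: ltnP. Qed.

Lemma mul2_letter00 : mul2 (coprod_letter K c) F ([::], [::]) = 0.
Proof.
rewrite /mul2 /= !big_ord1 coprod_letterE /=.
by rewrite eq_sym eqn0Ngt (valP c) mul0r.
Qed.

Lemma mul2_letter0w (b : letter) (v : word) :
  mul2 (coprod_letter K c) F ([::], b :: v) = (b == c)%:R * F ([::], v).
Proof.
rewrite /mul2 big_ord1
  (sum_splits_cons (f := fun x y => coprod_letter K c ([::], x) * F ([::], y))).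
  rewrite !coprod_letterE /= /weight /= !addn0 add0n.
  by rewrite eq_sym eqn0Ngt (valP c) mul0r add0r.
by move=> x y sx; rewrite coprod_letter_big ?sx ?mul0r.
Qed.

Lemma mul2_letterw0 (a : letter) (u : word) :
  mul2 (coprod_letter K c) F (a :: u, [::]) = (a == c)%:R * F (u, [::]).
Proof.
rewrite /mul2; under eq_bigr => i _ do rewrite big_ord1.
rewrite (sum_splits_cons
  (f := fun x y => coprod_letter K c (x, [::]) * F (y, [::]))).
  rewrite !coprod_letterE /= /weight /= !addn0.
  by rewrite eq_sym eqn0Ngt (valP c) mul0r add0r.
by move=> x y sx; rewrite coprod_letter_big ?sx ?mul0r.
Qed.

(** Of the four ways to cut off at most one letter from [a :: u] and [b :: v],
    cutting off nothing from either contributes nothing, because the weight of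
    [c] is positive; this is where [i >= 1] for the letters [y_i] matters. *)
Lemma mul2_letter_cons (a b : letter) (u v : word) :
  mul2 (coprod_letter K c) F (a :: u, b :: v) =
  (a == c)%:R * F (u, b :: v) + (b == c)%:R * F (a :: u, v) +
  (add_letter a b == c)%:R * F (u, v).
Proof.
rewrite /mul2 (sum_splits_cons (f := fun x y => \sum_(j < (size (b :: v)).+1)
  coprod_letter K c (x, take j (b :: v)) * F (y, drop j (b :: v)))); last first.
  by move=> x y sx; rewrite big1 // => j _; rewrite coprod_letter_big ?sx ?mul0r.
have split_v x y := sum_splits_cons (f := fun x' y' =>
  coprod_letter K c (x, x') * F (y, y')) b v.
rewrite !split_v;
  try by move=> x y sx; rewrite coprod_letter_big ?sx ?orbT ?mul0r.
rewrite !coprod_letterE /= /weight /= !addn0 add0n eq_sym eqn0Ngt (valP c).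
by rewrite mul0r add0r -!val_eqE /= addrCA addrA.
Qed.

End LetterProduct.

Lemma count_map_cons (c a : letter) (w : word) (l : seq word) :
  count_mem (c :: w) (map (cons a) l) = ((a == c) * count_mem w l)%N.
Proof.
rewrite count_map; case: (a =P c) => [->|/eqP ac].
  by rewrite mul1n; apply: eq_count => x /=; rewrite eqseq_cons eqxx.
rewrite mul0n (eq_count (a2 := pred0)) ?count_pred0 // => x /=.
by rewrite eqseq_cons (negbTE ac).
Qed.

Lemma count_nil_csh (u v : word) :
  count_mem [::] (csh u v) = (u == [::]) && (v == [::]).
Proof.
case: u v => [|a u] [|b v]; rewrite ?csh0w ?cshw0 //.
rewrite (permP (perm_csh_cons a b u v)) !count_cat !count_map.
by rewrite !(eq_count (a2 := pred0)) // !count_pred0.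
Qed.

(** Induction on [w]: the coproduct of its first letter obeys the recursion of
    the contracting shuffle. *)
Lemma coprod_word_count (K : fieldType) (w u v : word) :
  coprod_word K w (u, v) = (count_mem w (csh u v))%:R.
Proof.
elim: w u v => [|c w IH] u v /=.
  by rewrite count_nil_csh /one2 /tens /monom /= -natrM mulnb.
case: u v => [|a u] [|b v].
- by rewrite mul2_letter00 csh0w.
- rewrite mul2_letter0w IH !csh0w -natrM -count_map_cons //.
- rewrite mul2_letterw0 IH !cshw0 -natrM -count_map_cons //.
rewrite mul2_letter_cons !IH (permP (perm_csh_cons a b u v)) !count_cat.
by rewrite !count_map_cons !natrD !natrM addrA.
Qed.

(** The sum over all words that defines [coprod P] is supported in the finite
    list [csh u v], whose multiplicities are the coefficients. *)
Lemma coprod_csh (K : fieldType) (P : ncseries K) (u v : word) :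
  coprod P (u, v) = \sum_(w <- csh u v) P w.
Proof.
rewrite /coprod /formal_sum.
under eq_fsbigr => w _ do rewrite coprod_word_count mulr_natr.
rewrite -(fsbig_widen [set` csh u v]%classic setT) => [||w [_ /= wNcsh]] //.
  have -> : [set` csh u v]%classic = [set` undup (csh u v)]%classic.
    by apply/seteqP; split=> w /=; rewrite mem_undup.
  by rewrite -[RHS]big_undup_iterop_count -fsbig_seq ?undup_uniq.
by rewrite (count_memPn _) //; apply/negP.
Qed.

Theorem mainTheorem4 (K : fieldType) (charK : [pchar K]%R =i pred0)
    (M : mould K) (P : ncseries K)
    (PE : P = formal_sum (fun w w' => (M w * monom K w w')%R)) :
  grouplike P <-> symetrel M.
Proof.
rewrite PE formal_sum_monom; split=> [gM u v | sM].
  by rewrite -coprod_csh gM.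
by apply/funext => -[u v]; rewrite coprod_csh sM.
Qed.
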